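(* Let $p \ge 3$ be odd. If $\mathcal{P}$ is a tight orientably-regular polyhedron of type $\{p,q\}$, then $q$ is an even divisor of $2p$, and the automorphism group $\Gamma(\mathcal{P})$ is isomorphic to the group $$\Gamma(p,q)=\langle \rho_0,\rho_1,\rho_2 \mid \rho_0^2,\ \rho_1^2,\ \rho_2^2,\ (\rho_0\rho_1)^p,\ (\rho_1\rho_2)^q,\ (\rho_0\rho_2)^2,\ (\rho_0\rho_1\rho_2\rho_1\rho_2)^2\rangle.$$
   Context: A polyhedron is an abstract polytope of rank $3$ (a ranked poset with ranks $-1$ to $3$, unique least and greatest faces, flags of $5$ faces, connected sections, and the diamond condition). It has type $\{p,q\}$ if every $2$-face is a $p$-gon and every vertex-figure a $q$-gon; it is tight if it has exactly $2pq$ flags. It is regular if its automorphism group acts transitively on flags, in which case the group is generated by the reflections $\rho_0,\rho_1,\rho_2$ with respect to a base flag; it is orientably-regular if the rotation subgroup $\langle\rho_0\rho_1,\rho_1\rho_2\rangle$ has index $2$ in the automorphism group. *)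

(* Defs.v *)
From HB Require Import structures.
From mathcomp Require Import all_boot all_order all_algebra all_fingroup.
From mathcomp Require Import generic_quotient boolp.

Set Implicit Arguments.
Unset Strict Implicit.
Unset Printing Implicit Defensive.

Import Order.TTheory GRing.Theory Num.Theory.
Import GroupScope.

Local Open Scope quotient_scope.

(* The letter [(x, false)] stands for the generator [x], and [(x, true)] for
   its formal inverse. *)
Definition word (X : choiceType) := seq (X * bool).

Definition word_inv (X : choiceType) (w : word X) : word X :=
  rev [seq (a.1, ~~ a.2) | a <- w].

Definition word_pow (X : choiceType) (w : word X) (n : nat) : word X :=
  flatten (nseq n w).

Inductive word_eq (X : choiceType) (R : seq (word X)) :
    word X -> word X -> Prop :=
| word_eq_refl u : word_eq R u u
| word_eq_sym u v : word_eq R u v -> word_eq R v u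
| word_eq_trans v u w : word_eq R u v -> word_eq R v w -> word_eq R u w
| word_eq_cancel u v x b :
    word_eq R (u ++ [:: (x, b); (x, ~~ b)] ++ v) (u ++ v)
| word_eq_rel u v r : r \in R -> word_eq R (u ++ r ++ v) (u ++ v).

Section PresentedGroup.
Variables (X : choiceType) (R : seq (word X)).
Implicit Types u v w : word X.

Definition word_eqb : rel (word X) := fun u v => `[< word_eq R u v >].

Lemma word_eqbP u v : reflect (word_eq R u v) (word_eqb u v).
Proof. exact: asboolP. Qed.

Lemma word_eqb_refl : reflexive word_eqb.
Proof. by move=> u; apply/word_eqbP/word_eq_refl. Qed.

Lemma word_eqb_sym : symmetric word_eqb.
Proof.
by move=> u v; apply/word_eqbP/word_eqbP; apply: word_eq_sym.
Qed.

Lemma word_eqb_trans : transitive word_eqb.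
Proof.
move=> v u w /word_eqbP uv /word_eqbP vw.
by apply/word_eqbP; apply: word_eq_trans uv vw.
Qed.

Canonical word_equiv :=
  EquivRel word_eqb word_eqb_refl word_eqb_sym word_eqb_trans.

Definition presented_group := {eq_quot word_eqb}.

HB.instance Definition _ : EqQuotient _ word_eqb presented_group :=
  EqQuotient.on presented_group.
HB.instance Definition _ := Choice.on presented_group.

Definition word_class : word X -> presented_group := \pi_presented_group.

Lemma word_classP u v : word_class u = word_class v <-> word_eq R u v.
Proof.
by split=> [/eqmodP /word_eqbP | /word_eqbP uv] //; apply/eqmodP.
Qed.

Lemma word_classK (x : presented_group) : word_class (repr x) = x.
Proof. exact: reprK. Qed.

Lemma word_eq_ctx a b u v : word_eq R u v -> word_eq R (a ++ u ++ b) (a ++ v ++ b).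
Proof.
elim=> {u v} [u|u v _|v u w _ uv _ vw|u v x s|u v r Rr].
- exact: word_eq_refl.
- exact: word_eq_sym.
- exact: word_eq_trans uv vw.
- have := word_eq_cancel R (a ++ u) (v ++ b) x s.
  by rewrite -!catA.
- have := @word_eq_rel X R (a ++ u) (v ++ b) r Rr.
  by rewrite -!catA.
Qed.

Lemma word_eq_cat u u' v v' :
  word_eq R u u' -> word_eq R v v' -> word_eq R (u ++ v) (u' ++ v').
Proof.
move=> /(word_eq_ctx [::] v) uu' /(word_eq_ctx u' [::]) vv'.
by apply: word_eq_trans uu' _; rewrite !cats0 in vv'.
Qed.

Lemma word_invK : involutive (@word_inv X).
Proof.
move=> u; rewrite /word_inv map_rev revK -map_comp -[RHS]map_id.
by apply: eq_map => -[x b] /=; rewrite negbK.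
Qed.

Lemma word_inv_cat u v : word_inv (u ++ v) = word_inv v ++ word_inv u.
Proof. by rewrite /word_inv map_cat rev_cat. Qed.

Lemma word_eq_mulVw u : word_eq R (word_inv u ++ u) [::].
Proof.
elim: u => [|[x b] u IHu]; first exact: word_eq_refl.
apply: word_eq_trans IHu.
rewrite -cat1s word_inv_cat -!catA.
by have := word_eq_cancel R (word_inv u) u x (~~ b); rewrite negbK.
Qed.

Lemma word_eq_mulwV u : word_eq R (u ++ word_inv u) [::].
Proof. by have := word_eq_mulVw (word_inv u); rewrite word_invK. Qed.

Lemma word_eq_inv u v : word_eq R u v -> word_eq R (word_inv u) (word_inv v).
Proof.
move=> uv; apply: (@word_eq_trans _ _ (word_inv u ++ v ++ word_inv v)).
  apply: word_eq_sym; rewrite -[X in word_eq _ _ X]cats0.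
  by apply: word_eq_cat; [apply: word_eq_refl | apply: word_eq_mulwV].
rewrite catA -[X in word_eq _ _ X]cat0s.
apply: word_eq_cat; last exact: word_eq_refl.
apply: word_eq_trans (word_eq_mulVw u).
by apply: word_eq_cat; [apply: word_eq_refl | apply: word_eq_sym].
Qed.

Definition presented_mul (x y : presented_group) : presented_group :=
  word_class (repr x ++ repr y).
Definition presented_one : presented_group := word_class [::].
Definition presented_inv (x : presented_group) : presented_group :=
  word_class (word_inv (repr x)).

Lemma word_class_mul u v :
  presented_mul (word_class u) (word_class v) = word_class (u ++ v).
Proof.
apply/word_classP/word_eq_cat; apply/word_classP; exact: word_classK.
Qed.

Lemma word_class_inv u :
  presented_inv (word_class u) = word_class (word_inv u).
Proof.
apply/word_classP/word_eq_inv; apply/word_classP; exact: word_classK.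
Qed.

Lemma presented_mulA : associative presented_mul.
Proof.
move=> x y z; rewrite -[x]word_classK -[y]word_classK -[z]word_classK.
by rewrite !word_class_mul catA.
Qed.

Lemma presented_mul1 : left_id presented_one presented_mul.
Proof. by move=> x; rewrite -[x]word_classK word_class_mul. Qed.

Lemma presented_mulr1 : right_id presented_one presented_mul.
Proof. by move=> x; rewrite -[x]word_classK word_class_mul cats0. Qed.

Lemma presented_invK : involutive presented_inv.
Proof. by move=> x; rewrite -[x]word_classK !word_class_inv word_invK. Qed.

Lemma presented_invM :
  {morph presented_inv : x y / presented_mul x y >-> presented_mul y x}.
Proof.
move=> x y; rewrite -[x]word_classK -[y]word_classK.
by rewrite !(word_class_mul, word_class_inv) word_inv_cat.
Qed.

Lemma presented_mulV : left_inverse presented_one presented_inv presented_mul.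
Proof.
move=> x; rewrite -[x]word_classK word_class_inv word_class_mul.
exact/word_classP/word_eq_mulVw.
Qed.

HB.instance Definition _ := isStarMonoid.Build presented_group
  presented_mulA presented_mul1 presented_invK presented_invM.
HB.instance Definition _ := StarMonoid_isGroup.Build presented_group
  presented_mulV.

End PresentedGroup.

Definition gamma_relators (p q : nat) : seq (word 'I_3) :=
  let r0 : word 'I_3 := [:: (inord 0, false)] in
  let r1 : word 'I_3 := [:: (inord 1, false)] in
  let r2 : word 'I_3 := [:: (inord 2, false)] in
  [:: word_pow r0 2; word_pow r1 2; word_pow r2 2;
      word_pow (r0 ++ r1) p; word_pow (r1 ++ r2) q; word_pow (r0 ++ r2) 2;
      word_pow (r0 ++ r1 ++ r2 ++ r1 ++ r2) 2].

Definition gamma_group (p q : nat) : groupType :=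
  presented_group (gamma_relators p q).

Definition isomorphic (G H : groupType) : Prop :=
  exists2 f : G -> H, bijective f & {morph f : x y / x * y}.

(* The face poset of an [n]-gon; edge [j] joins the vertices [j] and
   [j + 1 mod n]. *)
Inductive ngon_face (n : nat) : Type :=
| NgonBot
| NgonVertex of 'I_n
| NgonEdge of 'I_n
| NgonTop.

Definition ngon_le n (x y : ngon_face n) : bool :=
  match x, y with
  | NgonBot, _ | _, NgonTop => true
  | NgonVertex i, NgonVertex j | NgonEdge i, NgonEdge j => i == j
  | NgonVertex i, NgonEdge j => (i == j) || (i == j.+1 %% n :> nat)
  | _, _ => false
  end.

(* Faces form a finite poset: every face lies on a flag and a flag has five
   faces, so a polyhedron with finitely many flags (in particular a tight one)
   has finitely many faces. *)
Section Polyhedra.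
Context {d : Order.disp_t} {T : finTBPOrderType d}.
Implicit Types (F G H x y : T) (A B : {set T}) (rk : T -> int).

Local Open Scope order_scope.

Definition is_chain A : bool := [forall x in A, forall y in A, x >=< y].

Definition flags : {set {set T}} := [set A | maxset is_chain A].

Definition proper_in_section F G : pred T := [pred x | F < x < G].

Record is_polyhedron rk : Prop := IsPolyhedron {
  rank_bot : rk \bot = (- 1)%R;
  rank_top : rk \top = 3%R;
  rank_lt x y : x < y -> (rk x < rk y)%R;
  rank_cover x y : x < y -> (forall z, ~~ (x < z < y)) -> rk y = (rk x + 1)%R;
  card_flag A : A \in flags -> #|A| = 5;
  (* The section [F, G] has rank [rk G - rk F - 1]; sections of rank at most 1
     are connected by convention. *)
  section_connected F G : F <= G -> (2 <= rk G - rk F - 1)%R ->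
    forall x y, proper_in_section F G x -> proper_in_section F G y ->
    connect [rel u v | [&& proper_in_section F G u,
                           proper_in_section F G v & u >=< v]] x y;
  diamond F G : F < G -> rk G = (rk F + 2)%R ->
    #|[set H | proper_in_section F G H]| = 2
}.

Definition section_is_ngon F G (n : nat) : Prop :=
  exists f : ngon_face n -> T,
    [/\ forall a, F <= f a <= G,
        forall x, F <= x <= G -> exists a, f a = x &
        forall a b, (f a <= f b) = ngon_le a b].

Definition has_type rk (p q : nat) : Prop :=
  (forall F, rk F = 2%R -> section_is_ngon \bot F p) /\
  (forall v, rk v = 0%R -> section_is_ngon v \top q).

Definition poset_aut_set : {set {perm T}} :=
  [set s : {perm T} | [forall x, forall y, (s x <= s y) == (x <= y)]].

Lemma poset_aut_group_set : group_set poset_aut_set.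
Proof.
apply/group_setP; split=> [|s t].
  by rewrite inE; apply/forallP=> x; apply/forallP=> y; rewrite !perm1.
rewrite !inE => /forallP sP /forallP tP.
apply/forallP=> x; apply/forallP=> y; rewrite !permM.
by rewrite (eqP (forallP (tP _) _)) (eqP (forallP (sP _) _)).
Qed.

Definition poset_aut : {group {perm T}} := Group poset_aut_group_set.

Definition is_regular : bool := [transitive poset_aut, on flags | 'P^*].

Definition adjacent rk (i : int) A B : Prop :=
  A != B /\ {in A, forall x, rk x != i -> x \in B}.

Definition is_reflection rk A (i : int) (s : {perm T}) : Prop :=
  s \in poset_aut /\ adjacent rk i A (s @: A).

(* For a regular polyhedron, another base flag conjugates the reflections, so
   the index does not depend on [A]. *)
Definition orientably_regular rk : Prop :=
  is_regular /\
  exists A (r0 r1 r2 : {perm T}),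
    [/\ A \in flags,
        is_reflection rk A 0%R r0,
        is_reflection rk A 1%R r1,
        is_reflection rk A 2%R r2 &
        #|poset_aut : <<[set r0 * r1; r1 * r2]>>| = 2].

End Polyhedra.

Arguments flags {d} T.
Arguments poset_aut {d} T.
Arguments is_regular {d} T.

Definition tight d (T : finTBPOrderType d) (p q : nat) : Prop :=
  #|flags T| = (2 * p * q)%N.

(* Main.v *)
Require Import Defs.
From HB Require Import structures.
From mathcomp Require Import all_boot all_order all_algebra all_fingroup.
From mathcomp Require Import cyclic pgroup zify.

(** Write [a = r0 r1], [b = r1 r2] and [H = <a, b>]. Flags are simply
    permuted by the automorphism group, so tightness gives [|H| = pq], hence
    [H = <a><b>] with [<a>] and [<b>] meeting trivially, and [r1] inverts both
    factors. As [p] is odd, an element of [H] commuting with [r1] lies in [<b>]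
    and squares to 1. The half-turn [r0 r2 = a b] is conjugate, by the power [y]
    of [a] with [y ^ 2 = a], to such an element, so [q] is even; were [q]
    divisible by 4, [r1] and [r2] would be conjugate and [a b] would lie in
    [<b>]. Hence [|H|] is twice an odd number, and by Cayley's parity argument
    the elements of odd order of [H] lie in a subgroup [N] of odd order. The
    involution [r1] acts on [N] without nontrivial fixed points, so [N] is
    abelian. Therefore [a] commutes with [b ^ 2], which is the last relator of
    the presentation, and [b a b^-1 = a^-1 b^-2] yields [b ^ (2 p) = 1].
    Conversely the relators reduce every word to [a ^ i b ^ j r1 ^ e] with
    [i < p], [j < q] and [e < 2], and these products are distinct in the
    automorphism group. *)

(** * Products of two cyclic groups inverted by an involution *)

Section DihedralFactorization.

Import GroupScope.
Set Implicit Arguments.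
Unset Strict Implicit.

(** * Parity of right translations of a finite group *)

Section Parity.
Variables (gT : finGroupType) (H : {group gT}).

Definition translation (x : gT) : {perm [subg H]} :=
  perm (mulIg (subg H x)).

Lemma translationM : {in H &, {morph translation : x y / x * y}}.
Proof.
by move=> x y xH yH; apply/permP=> z; rewrite permM !permE morphM // mulgA.
Qed.

(** A translation by an involution moves every point, so its orbits are [|H| / 2] pairs. The parity
    of a permutation is that of the number of points minus the number of orbits, here even minus
    odd. *)
Lemma odd_translation_involution x :
  odd #|H|./2 -> x \in H -> #[x] = 2 -> odd_perm (translation x).
Proof.
move=> oddH xH ox; set s := translation x.
have x2 : x ^+ 2 = 1 by rewrite -ox expg_order.
have s2 z : s (s z) = z.
  by rewrite !permE -mulgA -expg2 -morphX // x2 morph1 mulg1.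
have sN z : z != s z.
  rewrite permE -{1}[z]mulg1 (inj_eq (mulgI _)) eq_sym -(inj_eq val_inj) /=.
  by rewrite subgK // -order_eq1 ox.
have porb z : porbit s z = [set z; s z].
  apply/setP=> y; apply/porbitP/set2P=> [[i ->]|[]->]; last 2 first.
  - by exists 0%N; rewrite expg0 perm1.
  - by exists 1%N; rewrite expg1.
  elim: i => [|i [] IH]; rewrite ?expg0 ?perm1; first by left.
    by right; rewrite expgSr permM IH.
  by left; rewrite expgSr permM IH s2.
have cT : #|[subg H]| = (#|porbits s| * 2)%N.
  have -> : porbits s = porbit s @: [set: [subg H]].
    by apply/setP=> A; apply/imsetP/imsetP=> -[z _ ->]; exists z.
  apply: card_uniform_partition; last first.
    by rewrite porbit.unlock; apply: orbit_partition;
      apply/actsP=> g _ z; rewrite ![_ \in setT]inE.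
  by move=> A /imsetP[z _ ->]; rewrite porb cards2 sN.
have cH : #|H| = (#|porbits s| * 2)%N.
  by rewrite -cT -(card_injm (injm_sgval H)) ?im_sgval.
by rewrite /odd_perm -cardsT cT oddM andbF /=; rewrite cH muln2 doubleK in oddH.
Qed.

(* Cayley's argument: [N] consists of the elements whose translation is even;
   it has odd order because a translation by an involution is odd. *)
Lemma odd_order_elements_subgroup :
    odd #|H|./2 ->
  exists N : {group gT},
    [/\ N \subset H, odd #|N| & {in H, forall x, odd #[x] -> x \in N}].
Proof.
move=> oddH.
have tr1 : translation 1 = 1.
  by apply: (mulgI (translation 1)); rewrite -translationM ?mulg1.
pose N := [set x in H | ~~ odd_perm (translation x)].
have gN : group_set N.
  apply/group_setP; split=> [|x y]; first by rewrite inE group1 tr1 odd_perm1.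
  rewrite !inE => /andP[xH ex] /andP[yH ey]; rewrite groupM //=.
  by rewrite translationM // odd_permM (negPf ex) (negPf ey).
exists (Group gN); split=> [||x xH ox].
- by apply/subsetP=> x; rewrite inE => /andP[].
- apply/negPn/negP; rewrite -dvdn2 => /(Cauchy (isT : prime 2))[x].
  rewrite inE => /andP[xH /negP ex] ox.
  by apply: ex; apply: odd_translation_involution.
rewrite inE xH /=.
have trX n : odd_perm (translation (x ^+ n)) = odd n && odd_perm (translation x).
  elim: n => [|n IHn]; first by rewrite expg0 tr1 odd_perm1.
  by rewrite expgS translationM ?groupX // odd_permM IHn /=; case: odd_perm; case: odd.
by have := trX #[x]; rewrite expg_order tr1 odd_perm1 ox /= => <-.
Qed.
End Parity.

(** Since [t] centralizes only 1 in [N], the map sending [x] to [x^-1 * x ^ t] is injective, hence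
    onto [N]. Its values are inverted by [t], so inversion is a morphism on [N]. *)
Lemma involution_fpf_abelian (gT : finGroupType) (N : {group gT}) (t : gT) :
    t \in 'N(N) -> t ^+ 2 = 1 -> 'C_N[t] = 1 -> abelian N.
Proof.
move=> tN t2 fpf.
have tNx x : x \in N -> x ^ t \in N by move=> xN; rewrite memJ_norm.
have inj_f : {in N &, injective (fun x => x^-1 * x ^ t)}.
  move=> x y xN yN /= exy.
  have: y * x^-1 \in 'C_N[t].
    rewrite inE groupM ?groupV //=; apply/cent1P/commgP/eqP.
    rewrite commgEl conjMg conjVg invMg invgK.
    have ->: x ^ t = x * (y^-1 * y ^ t) by rewrite -exy mulKVg.
    by rewrite !gnorm.
  by rewrite fpf => /set1P/divg1_eq->.
have im_f : [set x^-1 * x ^ t | x in N] = N.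
  apply/eqP; rewrite eqEcard card_in_imset ?leqnn ?andbT //.
  by apply/subsetP=> _ /imsetP[x xN ->]; rewrite groupM ?groupV ?tNx.
have inv_f x : x \in N -> x ^ t = x^-1.
  rewrite -{1}im_f => /imsetP[y yN ->].
  rewrite conjMg conjVg -conjgM -expg2 t2 conjg1.
  by rewrite [in RHS]invMg invgK.
apply/centsP=> x xN y yN; apply: invg_inj.
by rewrite invMg -!inv_f ?groupM // conjMg.
Qed.

(** A cyclic group has at most one subgroup of each order, and a group of order 2 has one nontrivial
    element. *)
Lemma cyclic_involution_uniq (gT : finGroupType) (b x y : gT) :
  x \in <[b]> -> y \in <[b]> -> #[x] = 2 -> #[y] = 2 -> x = y.
Proof.
move=> xb yb ox oy.
have eqc: <[x]> = <[y]>.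
  apply/eqP; rewrite (eq_subG_cyclic (cycle_cyclic b)) ?cycle_subG //.
  by rewrite -!orderE ox oy.
have : x \in <[y]> by rewrite -eqc cycle_id.
rewrite cycle2g // => /set2P[] // x1.
by rewrite x1 order1 in ox.
Qed.

(** * Three involutions with a tight rotation subgroup *)

Section TightGroup.
Variables (gT : finGroupType) (r0 r1 r2 : gT) (p q : nat).
Local Notation a := (r0 * r1).
Local Notation b := (r1 * r2).
Local Notation H := (<<[set a; b]>>%G).
Hypotheses (r0K : r0 ^+ 2 = 1) (r1K : r1 ^+ 2 = 1) (r2K : r2 ^+ 2 = 1).
Hypotheses (r02 : commute r0 r2).
Hypotheses (r1_neq1 : r1 != 1) (r2_neq1 : r2 != 1) (r02_neq : r0 != r2).
Hypotheses (oa : #[a] = p) (ob : #[b] = q) (p_gt1 : 1 < p) (p_odd : odd p).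
Hypotheses (abTI : <[a]> :&: <[b]> = 1) (oH : #|H| = (p * q)%N).

Let r1V : r1^-1 = r1. Proof. by apply: mulg1_eq; rewrite -expg2. Qed.
Let r0V : r0^-1 = r0. Proof. by apply: mulg1_eq; rewrite -expg2. Qed.
Let r2V : r2^-1 = r2. Proof. by apply: mulg1_eq; rewrite -expg2. Qed.

Let aH : a \in H. Proof. by rewrite mem_gen // set21. Qed.
Let bH : b \in H. Proof. by rewrite mem_gen // set22. Qed.

Let aJ x : x \in <[a]> -> x ^ r1 = x^-1.
Proof.
case/cycleP=> k ->; rewrite conjXg -expVgn; congr (_ ^+ _).
by rewrite conjgE invMg r1V r0V -mulgA -expg2 r1K mulg1.
Qed.

Let bJ x : x \in <[b]> -> x ^ r1 = x^-1.
Proof.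
case/cycleP=> k ->; rewrite conjXg -expVgn; congr (_ ^+ _).
by rewrite conjgE r1V invMg r1V r2V !mulgA -expg2 r1K mul1g.
Qed.

Let HE : <[a]> * <[b]> = H.
Proof.
apply/eqP; rewrite eqEcard mul_subG ?cycle_subG //=.
by rewrite oH TI_cardMg // -!orderE oa ob leqnn.
Qed.

Let odd_a x : x \in <[a]> -> x ^+ 2 = 1 -> x = 1.
Proof.
move=> xa /eqP x2; apply/eqP; rewrite -order_eq1 -dvdn1.
have /eqP <-: coprime 2 p by rewrite coprime2n.
by rewrite dvdn_gcd order_dvdn x2 -oa order_dvdG.
Qed.

(** Write [x = y * w] with [y] in [<[a]>] and [w] in [<[b]>]. Commuting with [r1] means
    [y * w = y^-1 * w^-1], so [y ^ 2 = w ^- 2] lies in both factors and is 1; as [p] is odd,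
    [y = 1]. *)
Let centH x : x \in H -> commute x r1 -> x \in <[b]> /\ x ^+ 2 = 1.
Proof.
rewrite -HE => /mulsgP[y w ya wb ->] /commgP/conjg_fixP.
rewrite conjMg aJ // bJ // => e.
have e1 : y ^+ 2 = w ^- 2.
  rewrite -expVgn !expg2; apply: (mulIg w); rewrite mulgKV -mulgA -e.
  by rewrite mulKVg.
have y2 : y ^+ 2 \in <[a]> :&: <[b]>.
  by rewrite inE {2}e1 groupV !groupX.
move: y2; rewrite abTI => /set1P y2.
have y1 := odd_a ya y2; rewrite y1 mul1g.
by split=> //; rewrite -[LHS]invgK -e1 y1 expg1n invg1.
Qed.

(** Otherwise [centH] would put [r1] in [<[b]>], so that it both centralizes and inverts [b]. Then
    [<[b]>] has no elements but 1 and [b], and [r1 = r1 * r2] contradicts [r2 != 1]. *)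
Lemma r1_notin_rotations : r1 \notin H.
Proof.
apply/negP=> r1H; have [r1b _] := centH r1H (commute_refl r1).
have /bJ bV: b \in <[b]> by exact: cycle_id.
have cb : b ^ r1 = b.
  by apply/conjg_fixP/commgP; apply: (centsP (cycle_abelian b)); rewrite ?cycle_id.
have b2: b ^+ 2 = 1 by rewrite expg2 -{1}cb bV mulVg.
have: r1 \in [set 1; b].
  have [b1|nb1] := eqVneq b 1.
    by move: r1b; rewrite b1 cycle1 => /set1P->; rewrite set21.
  by rewrite -cycle2g //; apply: nt_prime_order.
rewrite !inE (negPf r1_neq1) /= -[X in X == _]mulg1 (inj_eq (mulgI _)) eq_sym.
by rewrite (negPf r2_neq1).
Qed.

(** As [p] is odd, [a ^ ((p + 1) / 2)] is a square root of [a]. It conjugates [r0] to [r1] ([r0J]),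
    hence the half-turn [r0 * r2] to an involution [u] commuting with [r1]. *)
Let u := (r0 * r2) ^ (a ^+ p.+1./2).

Let yV : a ^+ p.+1./2 * r1 = r1 * a ^- p.+1./2.
Proof. by rewrite conjgC aJ ?mem_cycle. Qed.

Let y2 : a ^+ p.+1./2 * a ^+ p.+1./2 = a.
Proof.
rewrite -expgnDr addnn even_halfK /= ?p_odd //.
by rewrite expgS -oa expg_order mulg1.
Qed.

Let r0J : r0 ^ (a ^+ p.+1./2) = r1.
Proof.
have r0E : r0 = a * r1 by rewrite -mulgA -expg2 r1K mulg1.
move: (a ^+ _) y2 yV => y yy yr; rewrite conjgE [in LHS]r0E -yy.
by rewrite -!mulgA mulKg mulgA yr mulgKV.
Qed.

Let r02K : (r0 * r2) ^+ 2 = 1.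
Proof. by rewrite expgMn // r0K r2K mulg1. Qed.

Let abE : a * b = r0 * r2.
Proof. by rewrite mulgA -(mulgA r0) -expg2 r1K mulg1. Qed.

Let r02H : r0 * r2 \in H. Proof. by rewrite -abE groupM. Qed.

Let ou : #[u] = 2.
Proof.
rewrite orderJ; apply: nt_prime_order => //.
by rewrite mulg_eq1 r2V.
Qed.

Let ub : u \in <[b]>.
Proof.
have [] // := @centH u _ _; first by rewrite groupJ ?groupX.
suff: commute u (r0 ^ a ^+ p.+1./2) by rewrite r0J.
by rewrite /commute /u -!conjMg -mulgA -r02 mulgA.
Qed.

Lemma rotation_order_even : ~~ odd q.
Proof. by rewrite -dvdn2 -ob -ou order_dvdG. Qed.

(** If 4 divided [q], then [u = b ^ j] would have [j] even, and [r2] would be conjugate to [r1]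
    under [H]. This conjugation sends [u] and [r0 * r2], two involutions commuting with [r2], to the
    only involution of [<[b]>]; so [a * b = u] and [a] lies in [<[b]>]. *)
Let q2_odd : odd q./2.
Proof.
apply/negPn/negP=> q2e.
have q4 : 4 %| q.
  rewrite -(even_halfK rotation_order_even) -muln2.
  by rewrite (@dvdn_pmul2r 2 2) // dvdn2.
have [j uj] := cycleP _ _ ub.
have u2 : u ^+ 2 = 1 by rewrite -ou expg_order.
have je : ~~ odd j.
  move/eqP: u2; rewrite uj -expgnA -order_dvdn ob => qj.
  by have := dvdn_trans q4 qj; rewrite (@dvdn_pmul2r 2 2) // dvdn2.
have r2J : r2 ^ (a ^+ p.+1./2) = r1 ^ (b ^+ j./2).
  have -> : r2 ^ (a ^+ p.+1./2) = r1 * u.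
    by rewrite /u conjMg r0J mulgA -expg2 r1K mul1g.
  rewrite conjgE.
  have <- : (b ^+ j./2) ^ r1 = b ^- j./2 by rewrite bJ ?mem_cycle.
  rewrite conjgE r1V -!mulgA (mulgA r1 r1) -expg2 r1K mul1g -expgnDr.
  by rewrite addnn uj even_halfK.
(* With [y = a ^ ((p + 1) / 2)], [r2 ^ y = r1 * b ^ j = r1 ^ (b ^ (j / 2))]; undoing the last
   conjugation takes [r2] to [r1]. *)
pose g := a ^+ p.+1./2 * b ^- j./2.
have gH : g \in H by rewrite groupM ?groupV ?groupX.
have r2g : r2 ^ g = r1 by rewrite /g conjgM r2J conjgK.
have key x : x \in H -> #[x] = 2 -> commute x r2 -> x ^ g \in <[b]> /\ #[x ^ g] = 2.
  move=> xH ox cx; split; last by rewrite orderJ.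
  have [] // := @centH (x ^ g) _ _; first by rewrite groupJ.
  by rewrite /commute -{1 2}r2g -!conjMg cx.
have [||ub1 ou1] := @key u _ ou.
- by rewrite groupJ ?groupX.
(* [u] is an involution in [<[b]>], so it commutes with [b] and with [r1], hence with
   [r2 = r1 * b]. *)
- have ur2 : commute u (r1 * b).
    apply: commuteM; last by apply: (centsP (cycle_abelian b)); rewrite ?cycle_id.
    by apply/commgP/conjg_fixP; rewrite bJ //; apply: mulg1_eq; rewrite -expg2.
  by rewrite mulgA -expg2 r1K mul1g in ur2.
have [||wb1 ow1] := @key (r0 * r2) r02H _ _.
- by rewrite -(orderJ _ (a ^+ p.+1./2)).
- by rewrite /commute mulgA -r02.
have /conjg_inj uw := cyclic_involution_uniq ub1 wb1 ou1 ow1.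
have ab : a \in <[b]>.
  rewrite -(mulgK b a) groupM ?groupV ?cycle_id //.
  by rewrite abE -uw.
have : a \in <[a]> :&: <[b]> by rewrite inE cycle_id.
by rewrite abTI => /set1P a1; move: p_gt1; rewrite -oa a1 order1.
Qed.

Lemma commute_sq_rotation : commute a (b ^+ 2).
Proof.
have [|N [sNH oN memN]] := @odd_order_elements_subgroup _ H.
  rewrite oH -(even_halfK rotation_order_even).
  by rewrite -doubleMr doubleK oddM p_odd.
have r1H x : x \in H -> x ^ r1 \in H.
  rewrite -HE => /mulsgP[y w ya wb ->]; rewrite conjMg aJ ?bJ //.
  by rewrite mem_mulg ?groupV.
(* [N] consists of all elements of odd order in [H], and [r1] normalizes [H]. *)
have r1N : r1 \in 'N(N).
  apply/normP/eqP; rewrite eqEcard cardJg leqnn andbT.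
  apply/subsetP=> _ /imsetP[x xN ->].
  apply: memN; first by rewrite r1H // (subsetP sNH).
  by rewrite orderJ (dvdn_odd (order_dvdG xN)).
have abN : abelian N.
  apply: (involution_fpf_abelian r1N r1K).
  apply/trivgP/subsetP=> x /setIP[xN /cent1P cx].
  have [_ /eqP x2] := centH (subsetP sNH _ xN) cx.
  apply/set1P/eqP; rewrite -order_eq1 -dvdn1.
  have /eqP <-: coprime 2 #|N| by rewrite coprime2n.
  by rewrite dvdn_gcd order_dvdn x2 order_dvdG.
apply: (centsP abN); apply: memN; rewrite ?groupX // ?oa //.
by rewrite orderXdiv ob ?divn2 ?q2_odd ?dvdn2 ?rotation_order_even.
Qed.

(** From [(a * b) ^ 2 = 1], the conjugate [b * a * b^-1] is the inverse of [b ^ 2 * a]. Its [p]-th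
    power is 1, and the two factors commute, so [b ^ (2 * p) = 1]. *)
Lemma rotation_order_dvd : q %| 2 * p.
Proof.
rewrite -ob order_dvdn expgnA.
have babV : b * a * b = a^-1.
  by apply/esym/mulg1_eq; rewrite -(mulgA b a b) (mulgA a b) abE -expg2.
have bJa : a ^ b^-1 = (b ^+ 2 * a)^-1.
  by rewrite [RHS]invMg -babV expg2 [(b * b)^-1]invMg mulgA !(mulgK b) conjgE invgK mulgA.
have : (a ^ b^-1) ^+ p = 1 by rewrite -conjXg -oa expg_order conj1g.
rewrite bJa expVgn expgMn; last exact/commute_sym/commute_sq_rotation.
by rewrite -[in a ^+ _]oa expg_order mulg1 => /eqP; rewrite invg_eq1.
Qed.

End TightGroup.
End DihedralFactorization.

(** * The presented group *)

Section Presentation.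

Import GroupScope.
Set Implicit Arguments.
Unset Strict Implicit.

(** * Evaluation of words in a group *)

Section WordEval.
Variables (X : choiceType) (M : groupType) (h : X -> M).

Definition word_eval (w : word X) : M :=
  foldr (fun a x => (if a.2 then (h a.1)^-1 else h a.1) * x) 1 w.

Lemma word_eval_cat u v : word_eval (u ++ v) = word_eval u * word_eval v.
Proof. by elim: u => [|a u IHu] /=; rewrite ?mul1g // IHu mulgA. Qed.

Lemma word_eval_pow w n : word_eval (word_pow w n) = word_eval w ^+ n.
Proof. by elim: n => // n IHn; rewrite expgS -IHn -word_eval_cat. Qed.

(** Von Dyck's principle: a choice of images that kills the relators factors through the presented
    group. *)
Lemma word_eval_eq (R : seq (word X)) :
    (forall r, r \in R -> word_eval r = 1) ->
  forall u v, word_eq R u v -> word_eval u = word_eval v.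
Proof.
move=> R1 u v; elim=> {u v} // [u v w _ -> _ -> //|u v x b|u v r /R1 r1].
  rewrite !word_eval_cat /= mulg1; congr (_ * _); rewrite -[RHS]mul1g.
  by congr (_ * _); case: b; rewrite /= ?mulVg ?mulgV.
by rewrite !word_eval_cat r1 mul1g.
Qed.
End WordEval.

(** * Normal form for products of the generators *)

Section NormalForm.
Variables (M : groupType) (x0 x1 x2 : M) (p q : nat).
Local Notation a := (x0 * x1).
Local Notation b := (x1 * x2).
Hypotheses (x0K : x0 ^+ 2 = 1) (x1K : x1 ^+ 2 = 1) (x2K : x2 ^+ 2 = 1).
Hypotheses (ap : a ^+ p = 1) (bq : b ^+ q = 1) (p_gt0 : 0 < p) (q_gt0 : 0 < q).
Hypotheses (x02K : (x0 * x2) ^+ 2 = 1).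
Hypotheses (x0bK : (x0 * b ^+ 2) ^+ 2 = 1).

(** [M] may be infinite; natural exponents suffice because [a ^+ p = 1] and [b ^+ q = 1] turn
    inverses into powers. *)
Let powers (c : M) (x : M) := exists i, x = c ^+ i.

Let powersM c x y : powers c x -> powers c y -> powers c (x * y).
Proof. by case=> i -> [j ->]; exists (i + j)%N; rewrite expgnDr. Qed.

Let powersV c n x : 0 < n -> c ^+ n = 1 -> powers c x -> powers c x^-1.
Proof.
case: n => // n _ cn [i ->]; exists (n * i)%N; rewrite expgnA -expVgn.
by congr (_ ^+ _); apply: mulg1_eq; rewrite -expgS.
Qed.

Let AV x : powers a x -> powers a x^-1. Proof. exact: powersV p_gt0 ap. Qed.
Let BV x : powers b x -> powers b x^-1. Proof. exact: powersV q_gt0 bq. Qed.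

Let involV (x : M) : x ^+ 2 = 1 -> x^-1 = x.
Proof. by move=> x2'; apply: mulg1_eq; rewrite -expg2. Qed.

Let aJ : a ^ x1 = a^-1.
Proof. by rewrite conjgE [RHS]invMg !involV // -mulgA -expg2 x1K mulg1. Qed.

Let bJ : b ^ x1 = b^-1.
Proof. by rewrite conjgE [RHS]invMg !involV // !mulgA -expg2 x1K mul1g. Qed.

Let abE : a * b = x0 * x2.
Proof. by rewrite mulgA -(mulgA x0) -expg2 x1K mulg1. Qed.

(** The last relator says that the involution [x0] inverts [b ^ 2]; [x1] inverts it too, so
    [a = x0 * x1] commutes with it. *)
Let ab2 : commute a (b ^+ 2).
Proof.
have x0E : x0 = a * x1 by rewrite -mulgA -expg2 x1K mulg1.
have e : b ^- 2 * a * x1 = a * x1 * b ^+ 2.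
  have /mulg1_eq : (x0 * b ^+ 2) * (x0 * b ^+ 2) = 1 by rewrite -expg2.
  by rewrite [LHS]invMg (involV x0K) => e; rewrite -(mulgA _ a x1) -x0E.
suff: commute a (b ^- 2) by move/commuteV; rewrite invgK.
apply/(mulIg x1); rewrite e -!(mulgA a); congr (_ * _).
by rewrite [LHS]conjgC conjVg conjXg bJ expVgn invgK.
Qed.

Let baE : b * a * b^-1 = a^-1 * b ^- 2.
Proof.
have <- : b * a * b = a^-1.
  by apply/esym/mulg1_eq; rewrite -(mulgA b a b) (mulgA a b) abE -expg2.
by rewrite expg2 [(b * b)^-1]invMg [RHS]mulgA (mulgK b).
Qed.

Let ABl (w y : M) : powers b w -> powers a y ->
  exists y' w', [/\ powers a y', powers b w' & w * y = y' * w'].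
Proof.
case=> j ->; elim: j y => [|j IHj] y Ay.
  by exists y, 1; split=> //; [exists 0%N | rewrite mul1g mulg1].
have [_ [v [[i ->] Bv e]]] := IHj y Ay.
(* Moving one factor: [b * a ^ i = (b * a * b^-1) ^ i * b = a ^ (-i) * b ^ (-2 i) * b], by [baE] and
   [ab2]. *)
exists (a^-1 ^+ i), (b^-1 ^+ 2 ^+ i * b * v); split.
- by rewrite expVgn; apply: AV; exists i.
- do 2![apply: powersM => //]; last by exists 1%N.
  by rewrite !expVgn; apply: BV; exists (2 * i)%N; rewrite expgnA.
rewrite expgS -mulgA e !mulgA; congr (_ * _).
have cab : commute a^-1 (b^-1 ^+ 2).
  by rewrite expVgn; apply/commuteV/commute_sym/commuteV/commute_sym/ab2.
rewrite -mulgA -expgMn // expVgn -baE [LHS]conjgCV conjXg.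
by congr (_ ^+ _ * _); rewrite conjgE invgK [LHS]mulgA.
Qed.

(** These products are stable under right multiplication by [x1], powers of [b] and powers of [a],
    thus by the generators [x0 = a * x1] and [x2 = x1 * b]. *)
Let nf x := exists y w (e : bool), [/\ powers a y, powers b w & x = y * w * x1 ^+ e].

Let nf_r1 x : nf x -> nf (x * x1).
Proof.
case=> y [w [e [Ay Bw ->]]]; exists y, w, (~~ e); split=> //.
rewrite -mulgA; congr (_ * _); case: e; first by rewrite -expg2.
by rewrite expg0 mul1g.
Qed.

Let nf_b x c : nf x -> powers b c -> nf (x * c).
Proof.
case=> y [w [e [Ay Bw ->]]] Bc.
case: e; last first.
  by exists y, (w * c), false; split; rewrite ?mulg1 ?mulgA //; apply: powersM.
exists y, (w * c^-1), true; split=> //; first by apply: powersM (BV Bc).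
rewrite !expg1 -!mulgA; congr (_ * (_ * _)).
by case: Bc => j ->; rewrite [LHS]conjgCV (involV x1K) conjXg bJ expVgn.
Qed.

Let nf_a x c : nf x -> powers a c -> nf (x * c).
Proof.
case=> y [w [e [Ay Bw ->]]] Ac.
have key d : powers a d -> nf (y * w * d * x1 ^+ e).
  move=> Ad; have [y' [w' [Ay' Bw' ed]]] := ABl Bw Ad.
  exists (y * y'), w', e; split=> //; first exact: powersM.
  by rewrite -(mulgA y w d) ed mulgA.
case: e key => key; last by have := key c Ac; rewrite !mulg1.
have := key _ (AV Ac); rewrite -!mulgA.
case: Ac => j ->; rewrite -expVgn -aJ -conjXg.
by rewrite [X in nf (_ * (_ * X)) -> _]conjgC -conjgM -expg2 x1K conjg1.
Qed.

Lemma normal_form (w : word 'I_3) (h : 'I_3 -> M) :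
    (forall i, h i = nth 1 [:: x0; x1; x2] i) ->
  exists i j (e : bool),
    [/\ i < p, j < q & word_eval h w = a ^+ i * b ^+ j * x1 ^+ e].
Proof.
move=> hE.
have nf_gen x (k : 'I_3) : nf x -> nf (x * nth 1 [:: x0; x1; x2] k).
  have x0E : a * x1 = x0 by rewrite -mulgA -expg2 x1K mulg1.
  have x2E : x1 * b = x2 by rewrite mulgA -expg2 x1K mul1g.
  move=> nfx; case: k => [[|[|[|//]]] ?] /=.
  - by rewrite -[X in _ * X]x0E mulgA; apply/nf_r1/nf_a => //; exists 1%N.
  - exact: nf_r1.
  by rewrite -[X in _ * X]x2E mulgA; apply/nf_b; [apply/nf_r1 | exists 1%N].
suff [y [v [e [[i ->] [j ->] ->]]]] : nf (word_eval h w).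
  exists (i %% p), (j %% q), e; split; rewrite ?ltn_pmod //.
  have modE (c : M) n k : c ^+ n = 1 -> c ^+ (k %% n) = c ^+ k.
    by move=> cn; rewrite {2}(divn_eq k n) expgnDr mulnC expgnA cn expg1n mul1g.
  by rewrite !modE.
(* Generators are involutions, so a formal inverse evaluates to the generator itself. *)
have genV (k : 'I_3) : (h k)^-1 = h k.
  by rewrite hE; case: k => [[|[|[|//]]] ?] /=; rewrite involV.
elim/last_ind: w => [|w [k s] IHw].
  by exists 1, 1, false; split; [exists 0%N | exists 0%N | rewrite !mulg1].
rewrite -cats1 word_eval_cat /= mulg1 genV if_same hE.
exact: nf_gen.
Qed.

End NormalForm.

(** * The isomorphism obtained from the normal form *)

Section PresentedIsomorphism.
Variables (gT : finGroupType) (G : {group gT}) (r0 r1 r2 : gT) (p q : nat).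
Local Notation a := (r0 * r1).
Local Notation b := (r1 * r2).
Hypotheses (r0K : r0 ^+ 2 = 1) (r1K : r1 ^+ 2 = 1) (r2K : r2 ^+ 2 = 1).
Hypotheses (r02K : (r0 * r2) ^+ 2 = 1) (r0bK : (r0 * b ^+ 2) ^+ 2 = 1).
Hypotheses (oa : #[a] = p) (ob : #[b] = q) (abTI : <[a]> :&: <[b]> = 1).
Hypotheses (r1H : r1 \notin <<[set a; b]>>) (genG : <<[set r0; r1; r2]>> = G).

Let h (k : 'I_3) : gT := nth 1 [:: r0; r1; r2] k.
Let R := gamma_relators p q.

Let hE : (h (inord 0) = r0) * (h (inord 1) = r1) * (h (inord 2) = r2).
Proof. by do !split; rewrite /h inordK. Qed.

Let relE (M : groupType) (g : 'I_3 -> M) :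
  [seq word_eval g r | r <- R] =
  let: (x0, x1, x2) := (g (inord 0), g (inord 1), g (inord 2)) in
  [:: x0 ^+ 2; x1 ^+ 2; x2 ^+ 2; (x0 * x1) ^+ p; (x1 * x2) ^+ q;
      (x0 * x2) ^+ 2; (x0 * (x1 * x2) ^+ 2) ^+ 2].
Proof. by rewrite /= !word_eval_pow /= !mulg1 !expg2 !mulgA. Qed.

Let h_rel r : r \in R -> word_eval h r = 1.
Proof.
move=> /(map_f (word_eval h)); rewrite relE !hE r0K r1K r2K r02K r0bK.
by rewrite -[in a ^+ p]oa -[in b ^+ q]ob !expg_order !inE !orbb => /eqP.
Qed.

Let cls (k : 'I_3) : gamma_group p q := word_class R [:: (k, false)].

Let eval_cls w : word_eval cls w = word_class R w.
Proof.
elim: w => [|[k s] w IHw] //; rewrite [LHS]/= IHw.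
have -> : (if s then (cls k)^-1 else cls k) = word_class R [:: (k, s)].
  by case: s => //; rewrite [LHS]word_class_inv.
by rewrite [LHS]word_class_mul.
Qed.

Let cls_rel r : r \in R -> word_eval cls r = 1.
Proof.
move=> Rr; rewrite eval_cls; apply/word_classP.
by have := word_eq_rel [::] [::] Rr; rewrite cats0.
Qed.

Let std_word i j (e : bool) : word 'I_3 :=
  word_pow [:: (inord 0, false); (inord 1, false)] i ++
  word_pow [:: (inord 1, false); (inord 2, false)] j ++
  word_pow [:: (inord 1, false)] e.

Let eval_std (M : groupType) (g : 'I_3 -> M) i j e :
  word_eval g (std_word i j e) =
  (g (inord 0) * g (inord 1)) ^+ i * (g (inord 1) * g (inord 2)) ^+ j *
  g (inord 1) ^+ e.
Proof. by rewrite !word_eval_cat !word_eval_pow /= !mulg1 mulgA. Qed.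

(** [normal_form] is applied in the presented group itself, where a word evaluates to its own
    class. *)
Let word_std w : exists i j (e : bool),
  [/\ i < p, j < q & word_eq R w (std_word i j e)].
Proof.
have : all (pred1 1) [seq word_eval cls r | r <- R].
  by apply/allP=> _ /mapP[r Rr ->]; rewrite /= cls_rel.
rewrite relE /= andbT => /and5P[/eqP c0 /eqP c1 /eqP c2 /eqP ca].
case/and3P=> /eqP cb /eqP c02 /eqP c0b.
have [||k|i [j [e [ip jq we]]]] := normal_form c0 c1 c2 ca cb _ _ c02 c0b w (h := cls).
- by rewrite -oa order_gt0.
- by rewrite -ob order_gt0.
- by case: k => [[|[|[|//]]] k3]; congr cls; apply: val_inj; rewrite /= inordK.
exists i, j, e; split=> //; apply/word_classP.
by rewrite -!eval_cls we eval_std.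
Qed.

(** A normal form equal to 1 has no factor [r1], which lies outside [<<[set a; b]>>]. Its powers of
    [a] and [b] are then mutually inverse, hence trivial, and the exponents vanish because [i < p]
    and [j < q]. *)
Let eval_inj w : word_eval h w = 1 -> word_eq R w [::].
Proof.
have [i [j [e [ip jq we]]]] := word_std w.
rewrite (word_eval_eq h_rel we) eval_std !hE => e1.
suff [i0 j0 e0] : [/\ i = 0, j = 0 & e = false]%N by rewrite i0 j0 e0 in we.
have aH : a \in <<[set a; b]>> by rewrite mem_gen ?set21.
have bH : b \in <<[set a; b]>> by rewrite mem_gen ?set22.
case: e e1 {we} => [/mulg1_eq e1|]; last rewrite mulg1.
  have: (a ^+ i * b ^+ j)^-1 \in <<[set a; b]>> by rewrite groupV groupM ?groupX.
  by rewrite e1 expgb /= (negPf r1H).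
move/mulg1_eq=> e1.
have: b ^+ j \in <[a]> :&: <[b]>.
  by rewrite inE -{1}e1 groupV !mem_cycle.
rewrite abTI => /set1P bj; rewrite bj in e1.
have ai : a ^+ i = 1 by rewrite -[LHS]invgK e1 invg1.
move/eqP: ai; move/eqP: bj; rewrite -!order_dvdn oa ob /dvdn !modn_small //.
by move=> /eqP-> /eqP->.
Qed.

Let eval_G w : word_eval h w \in G.
Proof.
elim: w => [|[k s] w IHw] /=; first exact: group1.
apply: groupM IHw; have hG : h k \in G.
  by rewrite -genG mem_gen // /h; case: k => [[|[|[|//]]] k3]; rewrite !inE eqxx ?orbT.
by case: s; rewrite ?groupV.
Qed.

(** The equality is boolean so that [xchoose] can pick a word; in a finite group, products of
    generators need no inverses. *)
Let eval_onto x : x \in G -> exists w, word_eval h w == x.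
Proof.
rewrite -genG => /gen_prodgP[n [c cG ->]].
elim: n c cG => [|n IHn] c cG; first by exists [::]; rewrite big_ord0.
have [|w /eqP we] := IHn (fun k => c (lift ord0 k)); first by move=> k; apply: cG.
have [k ck] : exists k, h k = c ord0.
  have := cG ord0; rewrite !inE -orbA => /or3P[]/eqP->.
  - by exists (inord 0); rewrite hE.
  - by exists (inord 1); rewrite hE.
  by exists (inord 2); rewrite hE.
by exists ((k, false) :: w); rewrite /= we ck big_ord_recl.
Qed.

(** Evaluation is a morphism [f] with trivial kernel, and choosing a word for each element of [G]
    gives a section [g]; the isomorphism is [g]. *)
Lemma presented_isomorphic : isomorphic [subg G]%type (gamma_group p q).
Proof.
pose f (x : presented_group R) : [subg G]%type :=
  subg G (word_eval h (generic_quotient.repr x)).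
have fE w : f (word_class R w) = subg G (word_eval h w).
  congr (subg G _); apply: (word_eval_eq h_rel).
  by apply/word_classP; rewrite word_classK.
pose g (x : [subg G]%type) : gamma_group p q :=
  word_class R (xchoose (eval_onto (subgP x))).
have gK : cancel g f.
  move=> x; rewrite /g fE; apply: val_inj.
  by rewrite /= subgK ?(eqP (xchooseP (eval_onto (subgP x)))) ?subgP.
have fM : {morph (f : gamma_group p q -> [subg G]%type) : x y / x * y}.
  move=> x y; rewrite -[x]word_classK -[y]word_classK.
  rewrite [X in f X]word_class_mul !fE word_eval_cat morphM //.
have f1 (x : gamma_group p q) : f x = 1 -> x = 1.
  rewrite -[x]word_classK fE => /(congr1 val); rewrite /= subgK // => /eval_inj.
  by move/word_classP.
have f_inj : injective f.
  move=> x y exy; apply: divg1_eq; apply: f1.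
  apply: (mulIg (f y)); rewrite -fM mulgVK mul1g //.
exists g; first by exists f => // x; apply: f_inj; rewrite gK.
by move=> x y; apply: f_inj; rewrite fM !gK.
Qed.
End PresentedIsomorphism.

End Presentation.

(** * The group-theoretic form of the theorem *)

Section TightRegularGroup.

Import GroupScope.

Lemma tight_regular_group (gT : finGroupType) (G : {group gT}) (r0 r1 r2 : gT)
    (p q : nat) :
    r0 \in G -> r1 \in G -> r2 \in G ->
    r0 ^+ 2 = 1 -> r1 ^+ 2 = 1 -> r2 ^+ 2 = 1 -> (r0 * r2) ^+ 2 = 1 ->
    r1 != 1 -> r2 != 1 -> r0 != r2 ->
    #[r0 * r1] = p -> #[r1 * r2] = q -> 1 < p -> odd p ->
    <[r0 * r1]> :&: <[r1 * r2]> = 1 -> #|G| = (2 * p * q)%N ->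
    #|G : <<[set r0 * r1; r1 * r2]>>| = 2 ->
  [/\ ~~ odd q, q %| 2 * p & isomorphic [subg G]%type (gamma_group p q)].
Proof.
move=> r0G r1G r2G r0K r1K r2K r02K r1n r2n r02n oa ob p_gt1 p_odd TI oG ind2.
set H := <<_>> in ind2.
have HG : H \subset G.
  by rewrite gen_subG; apply/subsetP=> x /set2P[]->; apply: groupM.
have oH : #|H| = (p * q)%N.
  have := Lagrange HG; rewrite [#|G : H|]ind2 oG -mulnA mulnC => /eqP.
  by rewrite eqn_pmul2l // => /eqP.
have invol (x : gT) : x ^+ 2 = 1 -> x^-1 = x by move=> x2; apply: mulg1_eq; rewrite -expg2.
have c02 : commute r0 r2.
  by rewrite /commute -(invol _ r02K) invMg !invol.
have r1H : r1 \notin H by apply: (r1_notin_rotations r0K r1K r2K r1n r2n oa ob).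
have ab2 : commute (r0 * r1) ((r1 * r2) ^+ 2).
  exact: (commute_sq_rotation r0K r1K r2K c02 r02n oa ob).
split.
- exact: (rotation_order_even r0K r1K r2K c02 r02n oa ob).
- exact: (rotation_order_dvd r0K r1K r2K c02 r02n oa ob).
apply: (presented_isomorphic r0K r1K r2K r02K _ oa ob TI r1H).
  (* [r0] is [(r0 * r1) * r1], whose first factor centralizes [(r1 * r2) ^+ 2] and whose second
     inverts it. So [r0] inverts it, which is the last relator. *)
  have b2J : ((r1 * r2) ^+ 2) ^ r0 = (r1 * r2) ^- 2.
    have -> : r0 = r0 * r1 * r1 by rewrite -mulgA -expg2 r1K mulg1.
    rewrite conjgM; have /conjg_fixP -> : [~ (r1 * r2) ^+ 2, r0 * r1] == 1.
      exact/commgP/commute_sym.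
    rewrite conjXg -expVgn; congr (_ ^+ _).
    by rewrite conjgE [RHS]invMg !invol // !mulgA -expg2 r1K mul1g.
  by rewrite expg2 mulgA -(mulgA r0) -{1}[r0]invol // -conjgE b2J mulVg.
apply/eqP; rewrite eqEcard gen_subG subUset sub1set; apply/andP; split.
  by rewrite !subUset !sub1set r0G r1G r2G.
set K := <<_>>.
have [K0 K1 K2] : [/\ r0 \in K, r1 \in K & r2 \in K].
  by split; rewrite mem_gen // !inE eqxx ?orbT.
(* [H] has index at least 2 in [K], since [K] also contains [r1], and index 2 in [G]; so [K = G]. *)
have HK : H \proper K.
  apply/properP; split; last by exists r1.
  by rewrite gen_subG; apply/subsetP=> x /set2P[]->; apply: groupM.
rewrite -(Lagrange HG) -(Lagrange (proper_sub HK)) leq_pmul2l ?cardG_gt0 //.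
by rewrite [#|G : H|]ind2 indexg_gt1 proper_subn.
Qed.

End TightRegularGroup.

(** * Faces and automorphisms of polyhedra *)

Section Polyhedron.

Import Order.TTheory GRing.Theory.
Set Implicit Arguments.
Unset Strict Implicit.
Local Open Scope order_scope.

Section Automorphisms.
Context {d : Order.disp_t} {T : finTBPOrderType d}.
Implicit Types (s t : {perm T}) (x y : T).

Lemma aut_le s x y : s \in poset_aut T -> (s x <= s y) = (x <= y).
Proof. by rewrite inE => /forallP/(_ x)/forallP/(_ y)/eqP. Qed.

Lemma aut_lt s x y : s \in poset_aut T -> (s x < s y) = (x < y).
Proof. by move=> sA; rewrite !lt_neqAle aut_le // (inj_eq perm_inj). Qed.

Lemma aut_bot s : s \in poset_aut T -> s \bot = \bot.
Proof.
by move=> sA; apply/eqP; rewrite -lex0 -[X in _ <= X](permKV s) aut_le // le0x.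
Qed.

Lemma aut_top s : s \in poset_aut T -> s \top = \top.
Proof.
by move=> sA; apply/eqP; rewrite -le1x -[X in X <= _](permKV s) aut_le // lex1.
Qed.
End Automorphisms.

(** * Ranks, diamonds and automorphisms fixing a flag *)

Section Ranks.
Context {d : Order.disp_t} {T : finTBPOrderType d} (rk : T -> int).
Hypothesis polyP : is_polyhedron rk.
Implicit Types (s t : {perm T}) (x y z : T).

Lemma rk_comparable_lt x y : x >=< y -> (rk x < rk y)%R -> x < y.
Proof.
move=> /orP[]; rewrite le_eqVlt => /orP[/eqP->|//]; rewrite ?ltxx //.
by move=> /(rank_lt polyP) lt1 lt2; have := lt_trans lt1 lt2; rewrite ltxx.
Qed.

Lemma rk_comparable_inj x y : x >=< y -> rk x = rk y -> x = y.
Proof.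
move=> /orP[]; rewrite le_eqVlt => /orP[/eqP->|/(rank_lt polyP)] //;
by move=> lt_xy eq_xy; rewrite eq_xy ltxx in lt_xy.
Qed.

Lemma rk_bounds x : ((-1)%R <= rk x <= 3%R)%R.
Proof.
have [<- <-] := (rank_bot polyP, rank_top polyP).
have [->|xb] := eqVneq x \bot.
  have [->|bt] := eqVneq (\bot : T) \top; first by rewrite !lexx.
  by rewrite lexx ltW // (rank_lt polyP) // lt_neqAle bt le0x.
have [xE|xt] := eqVneq x \top.
  by rewrite xE lexx andbT ltW // (rank_lt polyP) // lt_neqAle le0x andbT -xE eq_sym.
by rewrite !ltW ?(rank_lt polyP) // lt_neqAle ?le0x ?lex1 ?xt ?xb // eq_sym xb.
Qed.

Lemma exists_cover x : x != \bot ->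
  exists2 y, y < x & forall z, ~~ (y < z < x).
Proof.
move=> xb.
pose P y := y < x; have Pb : P \bot by rewrite /P lt_neqAle eq_sym xb le0x.
pose N y := #|[set z | y < z < x]|.
have [y Py ymin] := arg_minnP N Pb.
exists y => // z; apply/negP=> /andP[yz zx].
have := ymin z zx; rewrite leqNgt => /negP; apply; apply: proper_card.
apply/properP; split.
  by apply/subsetP=> w; rewrite !inE => /andP[zw ->]; rewrite (lt_trans yz).
by exists z; rewrite !inE ?ltxx // yz.
Qed.

(** Covers determine ranks, and automorphisms preserve covers. The induction is on [rk x + 1], which
    is nonnegative because ranks start at -1. *)
Lemma aut_rk s x : s \in poset_aut T -> rk (s x) = rk x.
Proof.
move=> sA; have [n] := ubnP (absz (rk x + 1)%R); elim: n x => // n IHn x.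
rewrite ltnS => xn; have [->|xb] := eqVneq x \bot; first by rewrite aut_bot.
have [y yx cov] := exists_cover xb.
rewrite (rank_cover polyP yx cov).
have -> : rk (s x) = (rk (s y) + 1)%R.
  apply: (rank_cover polyP); first by rewrite aut_lt.
  by move=> z; rewrite -[z](permKV s) !aut_lt.
rewrite IHn //; have := rk_bounds x; have := rk_bounds y; have := rank_lt polyP yx.
lia.
Qed.

Lemma flag_comparable (A : {set T}) : A \in flags T ->
  {in A &, forall x y, x >=< y}.
Proof.
rewrite inE => /maxsetp/forallP chA x y xA yA.
by have := chA x; rewrite xA => /forallP/(_ y); rewrite yA.
Qed.

(** Ranks are distinct along a chain, and a flag has five faces for the five values from -1 to 3. *)
Lemma flag_ranks (A : {set T}) (r : int) : A \in flags T ->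
  ((-1)%R <= r <= 3%R)%R -> exists2 x, x \in A & rk x = r.
Proof.
move=> Af rb; have cA := card_flag polyP Af; have chA := flag_comparable Af.
pose g x : 'I_5 := inord (absz (rk x + 1)%R).
have gE x : g x = absz (rk x + 1)%R :> nat.
  by rewrite inordK //; have := rk_bounds x; lia.
have g_inj : {in A &, injective g}.
  move=> x y xA yA /(congr1 val) /=; rewrite !gE => e.
  apply: rk_comparable_inj; first exact: chA.
  by have := rk_bounds x; have := rk_bounds y; lia.
have : g @: A = [set: 'I_5].
  by apply/eqP; rewrite eqEcard subsetT cardsT card_ord card_in_imset // cA.
move/setP/(_ (inord (absz (r + 1)%R))); rewrite inE => /imsetP[x xA /(congr1 val)] /=.
rewrite -/(g x) gE inordK; last by lia.
by move=> e; exists x => //; have := rk_bounds x; lia.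
Qed.

Lemma flag_faces (A : {set T}) : A \in flags T ->
  exists v e f, [/\ v \in A, e \in A & f \in A] /\
    [/\ rk v = 0%R, rk e = 1%R, rk f = 2%R, v < e & e < f].
Proof.
move=> Af; have cA := flag_comparable Af.
have [v vA rv] := flag_ranks (r := 0%R) Af isT.
have [e eA re] := flag_ranks (r := 1%R) Af isT.
have [f fA rf] := flag_ranks (r := 2%R) Af isT.
exists v, e, f; split=> //; split=> //.
  by apply: rk_comparable_lt; rewrite ?cA // rv re.
by apply: rk_comparable_lt; rewrite ?cA // re rf.
Qed.

Lemma flag_extends x y : x >=< y -> exists2 A, A \in flags T & (x \in A) && (y \in A).
Proof.
move=> xy.
have ch : @is_chain _ T [set x; y].
  apply/forallP=> u; apply/implyP=> /set2P[]->; apply/forallP=> w;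
    apply/implyP=> /set2P[]->; rewrite ?comparablexx //.
  by rewrite comparable_sym.
have [A mA sA] := maxset_exists ch.
by exists A; rewrite ?inE // !(subsetP sA) ?set21 ?set22.
Qed.

Lemma diamond_uniq F G x y z : rk G = (rk F + 2)%R ->
    F < x < G -> F < y < G -> F < z < G ->
  x != y -> x != z -> y = z.
Proof.
move=> rG xI yI zI xy xz; have FG : F < G by case/andP: xI; apply: lt_trans.
apply/eqP/negPn/negP=> yz.
have := diamond polyP FG rG; rewrite /proper_in_section => c2.
have : [set x; y; z] \subset [set H | proper_in_section F G H].
  by apply/subsetP=> w; rewrite !inE -orbA => /or3P[]/eqP->.
move/subset_leq_card; rewrite c2 (_ : #|[set x; y; z]| = 3) //.
by rewrite -setUA cardsU1 cards2 !inE negb_or xy xz yz.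
Qed.

Lemma rk_bot_inj x : rk x = (-1)%R -> x = \bot.
Proof.
move=> rx; apply: rk_comparable_inj; rewrite ?(rank_bot polyP) //.
by rewrite /Order.comparable le0x orbT.
Qed.

Lemma rk_top_inj x : rk x = 3%R -> x = \top.
Proof.
move=> rx; apply: rk_comparable_inj; rewrite ?(rank_top polyP) //.
by rewrite /Order.comparable lex1.
Qed.

Lemma rk_proper x : \bot < x < \top -> [\/ rk x = 0%R, rk x = 1%R | rk x = 2%R].
Proof.
case/andP=> /(rank_lt polyP); rewrite (rank_bot polyP) => lb.
move/(rank_lt polyP); rewrite (rank_top polyP) => lt.
have [r0|r1] : rk x = 0%R \/ (rk x = 1%R \/ rk x = 2%R) by lia.
  by constructor 1.
by case: r1; [constructor 2 | constructor 3].
Qed.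

Lemma diamond_fixed s F G x y : rk G = (rk F + 2)%R -> s \in poset_aut T ->
  s F = F -> s G = G -> s x = x -> F < x < G -> F < y < G -> s y = y.
Proof.
move=> rG sA sF sG sx xI yI; have [<-//|xy] := eqVneq x y.
apply/esym; apply: (diamond_uniq rG xI yI _ xy).
  by rewrite -[F]sF -[G]sG !aut_lt.
by rewrite -{1}sx (inj_eq perm_inj).
Qed.

Lemma diamond_swap s F G x : rk G = (rk F + 2)%R -> s \in poset_aut T ->
  s F = F -> s G = G -> F < x < G -> s x != x -> s (s x) = x.
Proof.
move=> rG sA sF sG xI sx.
have sI z : F < z < G -> F < s z < G.
  by rewrite -[X in _ -> X < _ < _]sF -[X in _ -> _ < _ < X]sG !aut_lt.
apply: (diamond_uniq rG (sI _ xI) (sI _ (sI _ xI)) xI) => //.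
by rewrite (inj_eq perm_inj) eq_sym.
Qed.

Lemma rk_gap3 F G x y : rk G = (rk F + 3)%R -> F < x -> x < y -> y < G ->
  rk x = (rk F + 1)%R /\ rk y = (rk F + 2)%R.
Proof.
move=> rG /(rank_lt polyP) + /(rank_lt polyP) + /(rank_lt polyP).
by rewrite rG; move: (rk F) (rk x) (rk y); clear; lia.
Qed.

(** Rigidity of a polygon. [Q u] says that [s] fixes all proper faces incident with [u]; by the
    diamond condition it holds once [u] and one other incident face are fixed, and connectedness
    carries it along a path to [z]. *)
Lemma section_fixed s F G x y : rk G = (rk F + 3)%R -> s \in poset_aut T ->
    s F = F -> s G = G -> s x = x -> s y = y -> F < x -> x < y -> y < G ->
  forall z, F < z < G -> s z = z.
Proof.
move=> rG sA sF sG sx sy Fx xy yG z zI.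
pose I := proper_in_section F G.
pose Q u := forall w, I w -> u >=< w -> s w = w.
have IE w : I w = (F < w < G) by [].
have lt_rk u w : u < w -> (rk u < rk w)%R by apply: (rank_lt polyP).
have no4 (u w t : T) : F < u -> u < w -> w < t -> t < G -> False.
  move=> Fu uw wt tG; have [rw _] := rk_gap3 rG (lt_trans Fu uw) wt tG.
  have [_] := rk_gap3 rG Fu uw (lt_trans wt tG).
  by rewrite rw => /eqP; rewrite (inj_eq (addrI _)).
have step u w : I u -> I w -> s u = u -> s w = w -> (u < w) || (w < u) -> Q u.
  rewrite !IE => /andP[Fu uG] /andP[Fw wG] su sw uw t; rewrite IE => /andP[Ft tG] /orP[].
    rewrite le_eqVlt => /orP[/eqP <-//|ut].
    case/orP: uw => [uw|wu]; last by case: (no4 w u t).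
    have [ru _] := rk_gap3 rG Fu ut tG.
    apply: (@diamond_fixed s u G w t); rewrite ?uw ?ut //.
    by rewrite rG ru -addrA.
  rewrite le_eqVlt => /orP[/eqP->//|tu].
  case/orP: uw => [uw|wu]; first by case: (no4 t u w).
  have [_ ru] := rk_gap3 rG Ft tu uG.
  by apply: (@diamond_fixed s F u w t); rewrite ?wu ?Fw ?Ft.
have Ix : I x by rewrite IE Fx (lt_trans xy).
have Iy : I y by rewrite IE yG (lt_trans Fx).
have Qx : Q x by apply: (step x y); rewrite ?xy.
have FG : F <= G by rewrite ltW // (lt_trans Fx) // (lt_trans xy).
have r3 : (2 <= rk G - rk F - 1)%R by lia.
have /connectP[c] := section_connected polyP FG r3 Ix zI.
move=> pc zE; suff [Qz _] : Q z /\ I z by apply: Qz; rewrite ?comparablexx.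
rewrite {}zE; elim: c x {sx Fx xy} Ix Qx pc => [|w c IHc] u Iu Qu //= /andP[].
case/and3P=> _ Iw uw; apply: IHc => //.
have [<-//|nuw] := eqVneq u w.
apply: (step w u) => //; try exact: Qu.
  by apply: Qu; rewrite ?comparablexx.
by case/orP: uw; rewrite le_eqVlt 1?[w == u]eq_sym (negPf nuw) => /= ->; rewrite ?orbT.
Qed.

(** Rigidity of the polyhedron. If [s] fixes a flag, the polygons [[v, \top]] and [[\bot, f]] and
    the diamonds at [e] show that it fixes every face incident with [v], [e] or [f] ([local]). A
    flag through two incident faces passes this on ([step]), and the whole poset is connected. *)
Lemma aut_fixing_flag s v e f : s \in poset_aut T ->
    rk v = 0%R -> rk e = 1%R -> rk f = 2%R -> v < e -> e < f ->
    s v = v -> s e = e -> s f = f ->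
  s = 1%g.
Proof.
move=> sA rv re rf ve ef sv se sf.
pose Q u := forall w, u >=< w -> s w = w.
have lt_rk u w : u < w -> (rk u < rk w)%R by apply: (rank_lt polyP).
have [sb st] := (aut_bot sA, aut_top sA).
have [rb rt] := (rank_bot polyP, rank_top polyP).
have botP (u : T) : u = \bot \/ \bot < u.
  by rewrite lt_neqAle le0x andbT eq_sym; case: eqVneq; [left | right].
have topP (u : T) : u = \top \/ u < \top.
  by rewrite lt_neqAle lex1 andbT; case: eqVneq; [left | right].
have local v1 e1 f1 : rk v1 = 0%R -> rk e1 = 1%R -> rk f1 = 2%R ->
    v1 < e1 -> e1 < f1 -> s v1 = v1 -> s e1 = e1 -> s f1 = f1 ->
    [/\ Q v1, Q e1 & Q f1].
  move=> rv1 re1 rf1 ve1 ef1 sv1 se1 sf1.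
  have bv1 : \bot < v1 by case: (botP v1) => // v1b; move: rv1; rewrite v1b rb.
  have f1t : f1 < \top by case: (topP f1) => // f1b; move: rf1; rewrite f1b rt.
  have be1 := lt_trans bv1 ve1; have e1t := lt_trans ef1 f1t.
  split=> w /orP[]; rewrite le_eqVlt => /orP[/eqP|].
  - by move<-.
  - move=> v1w; have [->//|wt] := topP w.
    by apply: (@section_fixed s v1 \top e1 f1); rewrite ?rv1 ?v1w.
  - by move->.
  - by move=> /lt_rk wv1; rewrite (@rk_bot_inj w) //; have := rk_bounds w; lia.
  - by move<-.
  - move=> e1w; have [->//|wt] := topP w.
    by apply: (@diamond_fixed s e1 \top f1); rewrite ?re1 ?e1w ?ef1.
  - by move->.
  - move=> we1; have [->//|bw] := botP w.
    by apply: (@diamond_fixed s \bot e1 v1); rewrite ?re1 ?rb ?bw ?bv1.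
  - by move<-.
  - by move=> /lt_rk fw; rewrite (@rk_top_inj w) //; have := rk_bounds w; lia.
  - by move->.
  move=> wf1; have [->//|bw] := botP w.
  by apply: (@section_fixed s \bot f1 v1 e1); rewrite ?rf1 ?rb ?bw.
have [Qv _ _] := local _ _ _ rv re rf ve ef sv se sf.
have step u w : Q u -> \bot < w < \top -> u >=< w -> Q w.
  move=> Qu wI uw; have [A Af /andP[uA wA]] := flag_extends uw.
  have cA := flag_comparable Af.
  have [v1 [e1 [f1 [[v1A e1A f1A] [rv1 re1 rf1 ve1 ef1]]]]] := flag_faces Af.
  have [||| Qv1 Qe1 Qf1] := local _ _ _ rv1 re1 rf1 ve1 ef1; try exact/Qu/cA.
  case: (rk_proper wI) => rw.
  - by rewrite (@rk_comparable_inj w v1) ?rw //; apply: cA.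
  - by rewrite (@rk_comparable_inj w e1) ?rw //; apply: cA.
  by rewrite (@rk_comparable_inj w f1) ?rw //; apply: cA.
apply/permP=> x; rewrite perm1.
have [->//|bx] := botP x; have [->//|xt] := topP x.
have bt : \bot <= \top :> T by rewrite le0x.
have r4 : (2 <= rk \top - rk \bot - 1)%R by rewrite rb rt.
have Iv : proper_in_section \bot \top v.
  by apply/andP; split; [case: (botP v) | case: (topP v)] => // vE;
    move: rv; rewrite vE ?rb ?rt.
have Ix : proper_in_section \bot \top x by apply/andP.
have /connectP[c] := section_connected polyP bt r4 Iv Ix.
move=> pc xE; suff: Q x by apply; rewrite comparablexx.
rewrite {}xE {Ix bx xt x}.
elim: c v Qv pc {rv ve sv Iv} => [|w c IHc] u Qu //= /andP[/and3P[_ Iw uw]].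
by apply: IHc; apply: step Iw uw.
Qed.

Lemma reflection_fixes A i s x : A \in flags T -> is_reflection rk A i s ->
  x \in A -> rk x != i -> s x = x.
Proof.
move=> Af [sA [_ adj]] xA rx; have /imsetP[y yA xE] := adj x xA rx.
suff yx : y = x by rewrite -{1}yx -xE.
by apply: rk_comparable_inj; rewrite ?(flag_comparable Af) // xE aut_rk.
Qed.

Lemma reflection_moves A i s x : A \in flags T -> is_reflection rk A i s ->
  x \in A -> rk x = i -> s x != x.
Proof.
move=> Af sR xA rx; have [sA [/negP nA adj]] := sR.
apply/negP=> /eqP sx; apply: nA; apply/eqP.
have sE y : y \in A -> s y = y.
  move=> yA; have [ry|ry] := eqVneq (rk y) i; last exact: reflection_fixes sR yA ry.
  by rewrite (@rk_comparable_inj y x) ?ry ?rx // (flag_comparable Af).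
apply/setP=> y; apply/idP/imsetP=> [yA|[z zA ->]]; last by rewrite sE.
by exists y; rewrite ?sE.
Qed.

End Ranks.
End Polyhedron.

(** * Rotations of a polygon *)

Section Ngon.

Import Order.TTheory GRing.Theory.
Set Implicit Arguments.
Unset Strict Implicit.
Local Open Scope order_scope.

Lemma iter_ordS n (i : 'I_n) k : iter k (@ordS n) i = (i + k)%N %% n :> nat.
Proof.
elim: k => [|k IHk]; first by rewrite addn0 modn_small.
by rewrite iterS /= IHk addnS -addn1 modnDml addn1.
Qed.

Lemma iter_ordS_fix n (i : 'I_n) k : (iter k (@ordS n) i == i) = (n %| k)%N.
Proof.
rewrite -val_eqE /= iter_ordS -[X in _ == X](modn_small (ltn_ord i)).
by rewrite -[X in _ == X %% n]addn0 eqn_modDl mod0n.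
Qed.

Lemma iter_ord_pred_fix n (i : 'I_n) k : (iter k (@ord_pred n) i == i) = (n %| k)%N.
Proof.
have S_inj : injective (iter k (@ordS n)).
  by elim: k => [|k IHk] x y //= /ordS_inj/IHk.
rewrite -(iter_ordS_fix i) -(inj_eq S_inj) eq_sym; congr (_ == _).
elim: k {S_inj} => // k IHk; rewrite iterSr -[RHS]IHk.
by congr (iter k _ _); rewrite iterS ord_predK.
Qed.

Context {d : Order.disp_t} {T : finTBPOrderType d}.
Variables (F G : T) (n : nat).
Hypothesis nP : section_is_ngon F G n.

(* The corners [a^k x, a^k y] of the polygon visited by a rotation [a] advance in
   a constant direction, because each edge is left through its other endpoint. *)
Lemma ngon_rotation_fix (a : {perm T}) x y :
    a \in poset_aut T -> a F = F -> a G = G ->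
    F < x -> x < y -> y < G -> x < a y -> a x != x -> a y != y ->
  forall k, (((a ^+ k)%g x == x) = (n %| k)%N) /\
            (((a ^+ k)%g y == y) = (n %| k)%N).
Proof.
move=> aA aF aG Fx xy yG xay ax ay.
have [phi [phiI phiO phiM]] := nP.
have phi_bot : phi (NgonBot n) = F.
  apply/eqP; rewrite eq_le (andP (phiI _)).1 andbT.
  have [|c <-] := phiO F; first by rewrite lexx ltW // (lt_trans Fx) // (lt_trans xy).
  by rewrite phiM.
have phi_top : phi (NgonTop n) = G.
  apply/eqP; rewrite eq_le (andP (phiI _)).2 /=.
  have [|c <-] := phiO G; first by rewrite lexx andbT ltW // (lt_trans Fx) // (lt_trans xy).
  by rewrite phiM; case: c.
have corner u w : F < u -> u < w -> w < G ->
    exists i j, [/\ u = phi (NgonVertex i), w = phi (NgonEdge j)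
                  & i = j \/ i = ordS j].
  move=> Fu uw wG.
  have [|c uE] := phiO u; first by rewrite !ltW // (lt_trans uw).
  have [|e wE] := phiO w; first by rewrite !ltW // (lt_trans Fu).
  move: Fu uw wG; rewrite -{}uE -{}wE !lt_neqAle phiM.
  case: c => [|i|i|]; case: e => [|j|j|]; rewrite ?phi_bot ?phi_top ?eqxx ?andbF //=.
  - by move=> _ /andP[+ /eqP ij]; rewrite ij eqxx.
  - move=> _ /andP[_ ij] _; exists i, j; split=> //.
    by case/orP: ij => /eqP ij; [left | right]; apply: val_inj; rewrite /= ?ij.
  - by move=> _ /andP[+ /eqP ij]; rewrite ij eqxx.
have V_inj i j : phi (NgonVertex i) = phi (NgonVertex j) -> i = j.
  move=> e; have := phiM (NgonVertex i) (NgonVertex j).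
  by rewrite e lexx => /esym/eqP.
have E_inj i j : phi (NgonEdge i) = phi (NgonEdge j) -> i = j.
  move=> e; have := phiM (NgonEdge i) (NgonEdge j).
  by rewrite e lexx => /esym/eqP.
have akA k : (a ^+ k)%g \in poset_aut T by rewrite groupX.
have aFk k : (a ^+ k)%g F = F.
  by elim: k => [|k IHk]; rewrite ?expg0 ?perm1 // expgSr permM IHk.
have aGk k : (a ^+ k)%g G = G.
  by elim: k => [|k IHk]; rewrite ?expg0 ?perm1 // expgSr permM IHk.
(* The vertex [a^k x] lies on both edges [a^k y] and [a^(k+1) y], because [x < a y]; as consecutive
   corners differ in both vertex and edge, this pins down the next one. *)
have step k i j : (a ^+ k)%g x = phi (NgonVertex i) ->
    (a ^+ k)%g y = phi (NgonEdge j) ->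
    exists i' j', [/\ (a ^+ k.+1)%g x = phi (NgonVertex i'),
      (a ^+ k.+1)%g y = phi (NgonEdge j'), i' != i, j' != j &
      (i' = j' \/ i' = ordS j') /\ (i = j' \/ i = ordS j')].
  move=> xE yE.
  have xE' : (a ^+ k.+1)%g x = (a ^+ k)%g (a x) by rewrite expgS permM.
  have yE' : (a ^+ k.+1)%g y = (a ^+ k)%g (a y) by rewrite expgS permM.
  have [||| i' [j' [x'E y'E ij']]] := corner ((a ^+ k.+1)%g x) ((a ^+ k.+1)%g y).
  - by rewrite -(aFk k.+1) aut_lt.
  - by rewrite aut_lt.
  - by rewrite -[X in _ < X](aGk k.+1) aut_lt.
  have [||| i2 [j2 [x2E y2E ij2]]] := corner ((a ^+ k)%g x) ((a ^+ k.+1)%g y).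
  - by rewrite -(aFk k) aut_lt.
  - by rewrite yE' aut_lt.
  - by rewrite -[X in _ < X](aGk k.+1) aut_lt.
  exists i', j'; split=> //.
  - apply: contraNneq ax => ii; rewrite -(inj_eq (@perm_inj _ (a ^+ k)%g)).
    by rewrite -xE' x'E ii xE.
  - apply: contraNneq ay => jj; rewrite -(inj_eq (@perm_inj _ (a ^+ k)%g)).
    by rewrite -yE' y'E jj yE.
  split=> //; rewrite y2E in y'E; rewrite xE in x2E.
  by rewrite (V_inj _ _ x2E) -(E_inj _ _ y'E).
(* If the vertex is the first endpoint of its edge ([i = j]), indices decrease by one at each step;
   if it is the second, they increase. *)
have [i [j [x0E y0E [ij|ij]]]] := corner x y Fx xy yG.
  have H k : (a ^+ k)%g x = phi (NgonVertex (iter k (@ord_pred n) j)) /\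
             (a ^+ k)%g y = phi (NgonEdge (iter k (@ord_pred n) j)).
    elim: k => [|k [xk yk]]; first by rewrite !perm1 x0E y0E ij.
    have [i' [j' [-> -> ni nj [ij' ii']]]] := step _ _ _ xk yk.
    have ej : j' = ord_pred (iter k (@ord_pred n) j).
      case: ii' => [e|->]; last by rewrite ordSK.
      by rewrite -e eqxx in nj.
    rewrite iterS -ej; split=> //; case: ij' => [-> //|e].
    by rewrite e ej ord_predK eqxx in ni.
  move=> k; have [-> ->] := H k; rewrite x0E y0E ij -(iter_ord_pred_fix j k).
  by split; [apply/eqP/eqP=> [/V_inj|->] | apply/eqP/eqP=> [/E_inj|->]].
have H k : (a ^+ k)%g x = phi (NgonVertex (ordS (iter k (@ordS n) j))) /\
           (a ^+ k)%g y = phi (NgonEdge (iter k (@ordS n) j)).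
  elim: k => [|k [xk yk]]; first by rewrite !perm1 x0E y0E ij.
  have [i' [j' [-> -> ni nj [ij' ii']]]] := step _ _ _ xk yk.
  have ej : j' = ordS (iter k (@ordS n) j).
    by case: ii' => [-> //|/ordS_inj e]; rewrite e eqxx in nj.
  rewrite iterS -ej; split=> //; case: ij' => [e|-> //].
  by rewrite e ej eqxx in ni.
move=> k; have [-> ->] := H k; rewrite x0E y0E ij -(iter_ordS_fix j k).
by split; [apply/eqP/eqP=> [/V_inj/ordS_inj|->] | apply/eqP/eqP=> [/E_inj|->]].
Qed.

End Ngon.

(** * Reflections and rotations of the base flag *)

Section BaseFlag.

Import Order.TTheory GroupScope.
Set Implicit Arguments.
Unset Strict Implicit.
Local Open Scope order_scope.

Context {d : Order.disp_t} {T : finTBPOrderType d} (rk : T -> int) (p q : nat).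
Hypotheses (polyP : is_polyhedron rk) (typeP : has_type rk p q).
Variables (A : {set T}) (v e f : T) (r0 r1 r2 : {perm T}).
Hypotheses (Af : A \in flags T) (vA : v \in A) (eA : e \in A) (fA : f \in A).
Hypotheses (rv : rk v = 0%R) (re : rk e = 1%R) (rf : rk f = 2%R).
Hypotheses (ve : v < e) (ef : e < f).
Hypotheses (R0 : is_reflection rk A 0%R r0) (R1 : is_reflection rk A 1%R r1).
Hypothesis (R2 : is_reflection rk A 2%R r2).
Local Notation a := (r0 * r1).
Local Notation b := (r1 * r2).

Let A0 : r0 \in poset_aut T. Proof. by case: R0. Qed.
Let A1 : r1 \in poset_aut T. Proof. by case: R1. Qed.
Let A2 : r2 \in poset_aut T. Proof. by case: R2. Qed.

Let r0e : r0 e = e. Proof. by apply: (reflection_fixes polyP Af R0); rewrite ?re. Qed.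
Let r0f : r0 f = f. Proof. by apply: (reflection_fixes polyP Af R0); rewrite ?rf. Qed.
Let r1v : r1 v = v. Proof. by apply: (reflection_fixes polyP Af R1); rewrite ?rv. Qed.
Let r1f : r1 f = f. Proof. by apply: (reflection_fixes polyP Af R1); rewrite ?rf. Qed.
Let r2v : r2 v = v. Proof. by apply: (reflection_fixes polyP Af R2); rewrite ?rv. Qed.
Let r2e : r2 e = e. Proof. by apply: (reflection_fixes polyP Af R2); rewrite ?re. Qed.
Let r0v : r0 v != v. Proof. exact: (reflection_moves polyP Af R0). Qed.
Let r1e : r1 e != e. Proof. exact: (reflection_moves polyP Af R1). Qed.
Let r2f : r2 f != f. Proof. exact: (reflection_moves polyP Af R2). Qed.

Let free s : s \in poset_aut T -> s v = v -> s e = e -> s f = f -> s = 1.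
Proof. by move=> sA; apply: (aut_fixing_flag polyP sA rv re rf ve ef). Qed.

Let bv : \bot < v.
Proof.
by rewrite lt_neqAle le0x andbT; apply: contra_eq_neq rv => <-; rewrite (rank_bot polyP).
Qed.

Let ft : f < \top.
Proof.
by rewrite lt_neqAle lex1 andbT; apply: contra_eq_neq rf => ->; rewrite (rank_top polyP).
Qed.

Let rank_e : rk e = (rk \bot + 2)%R. Proof. by rewrite re (rank_bot polyP). Qed.
Let rank_f : rk f = (rk v + 2)%R. Proof. by rewrite rf rv. Qed.
Let rank_t : rk \top = (rk e + 2)%R. Proof. by rewrite re (rank_top polyP). Qed.

(** [r0] exchanges the two vertices of [e], so its square fixes the base flag. The same argument
    serves [r1] between [v] and [f], and [r2] between [e] and [\top]. *)
Lemma reflection0K : r0 ^+ 2 = 1.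
Proof.
apply: free; rewrite ?groupX // expg2 !permM ?r0e ?r0f //.
by apply: (diamond_swap polyP rank_e) => //; rewrite ?aut_bot ?bv.
Qed.

Lemma reflection1K : r1 ^+ 2 = 1.
Proof.
apply: free; rewrite ?groupX // expg2 !permM ?r1v ?r1f //.
by apply: (diamond_swap polyP rank_f) => //; rewrite ve.
Qed.

Lemma reflection2K : r2 ^+ 2 = 1.
Proof.
apply: free; rewrite ?groupX // expg2 !permM ?r2v ?r2e //.
by apply: (diamond_swap polyP rank_t) => //; rewrite ?aut_top ?ef.
Qed.

Let r0_conv x : r0 (r0 x) = x.
Proof. by rewrite -permM -expg2 reflection0K perm1. Qed.

Let r2_conv x : r2 (r2 x) = x.
Proof. by rewrite -permM -expg2 reflection2K perm1. Qed.

(** [r2] fixes both vertices of [e] and [r0] fixes both 2-faces on [e], so [(r0 * r2) ^ 2] fixes the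
    base flag. *)
Lemma reflection02K : (r0 * r2) ^+ 2 = 1.
Proof.
have r2r0v : r2 (r0 v) = r0 v.
  apply: (diamond_fixed polyP rank_e A2 _ r2e r2v); rewrite ?aut_bot ?bv //.
  by rewrite -[\bot](aut_bot A0) -[e]r0e !aut_lt ?bv.
have r0r2f : r0 (r2 f) = r2 f.
  apply: (diamond_fixed polyP rank_t A0 r0e _ r0f); rewrite ?aut_top ?ef //.
  by rewrite -[\top](aut_top A2) -[e]r2e !aut_lt ?ef.
apply: free; rewrite ?groupX ?groupM // expg2 !permM.
- by rewrite r2r0v r0_conv r2v.
- by rewrite !(r0e, r2e).
by rewrite r0f r0r2f r2_conv.
Qed.

Lemma reflections_distinct : [/\ r1 != 1, r2 != 1 & r0 != r2].
Proof.
split.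
- by apply: contraNneq r1e => ->; rewrite perm1.
- by apply: contraNneq r2f => ->; rewrite perm1.
by apply: contraNneq r0v => ->; rewrite r2v.
Qed.

(** Permutations compose from left to right, so [a e = r1 e], and this edge contains [r1 v = v], as
    [ngon_rotation_fix] requires; [b] is treated alike. *)
Let a_fix k : (((a ^+ k) v == v) = (p %| k)%N) /\ (((a ^+ k) e == e) = (p %| k)%N).
Proof.
apply: (ngon_rotation_fix (typeP.1 f rf)) => //; rewrite ?groupM //.
- by rewrite permM !aut_bot.
- by rewrite permM r0f r1f.
- by rewrite permM r0e -{1}r1v aut_lt.
- by rewrite permM -{2}r1v (inj_eq perm_inj).
by rewrite permM r0e.
Qed.

Let b_fix k : (((b ^+ k) e == e) = (q %| k)%N) /\ (((b ^+ k) f == f) = (q %| k)%N).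
Proof.
apply: (ngon_rotation_fix (typeP.2 v rv)) => //; rewrite ?groupM //.
- by rewrite permM r1v r2v.
- by rewrite permM !aut_top.
- by rewrite permM r1f -{1}r2e aut_lt.
- by rewrite permM -{2}r2e (inj_eq perm_inj).
by rewrite permM r1f.
Qed.

Let a_f k : (a ^+ k) f = f.
Proof. by elim: k => [|k IHk]; rewrite ?perm1 // expgSr !permM IHk r0f r1f. Qed.

Let b_v k : (b ^+ k) v = v.
Proof. by elim: k => [|k IHk]; rewrite ?perm1 // expgSr !permM IHk r1v r2v. Qed.

Let a_eq1 k : (a ^+ k == 1) = (p %| k)%N.
Proof.
apply/eqP/idP=> [ak|pk]; first by rewrite -(a_fix k).1 ak perm1.
apply: free; rewrite ?groupX ?groupM //; apply/eqP; first by rewrite (a_fix k).1.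
by rewrite (a_fix k).2.
Qed.

Let b_eq1 k : (b ^+ k == 1) = (q %| k)%N.
Proof.
apply/eqP/idP=> [bk|qk]; first by rewrite -(b_fix k).1 bk perm1.
apply: free; rewrite ?groupX ?groupM //; apply/eqP; first by rewrite (b_fix k).1.
by rewrite (b_fix k).2.
Qed.

Lemma facet_rotation_order : #[a] = p.
Proof.
by apply/eqP; rewrite eqn_dvd order_dvdn a_eq1 dvdnn -a_eq1 expg_order eqxx.
Qed.

Lemma vertex_rotation_order : #[b] = q.
Proof.
by apply/eqP; rewrite eqn_dvd order_dvdn b_eq1 dvdnn -b_eq1 expg_order eqxx.
Qed.

(** A common element fixes [v], being a power of [b], and a power of [a] fixing [v] is trivial. *)
Lemma rotations_TI : <[a]> :&: <[b]> = 1.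
Proof.
apply/trivgP/subsetP=> g /setIP[/cycleP[i ->] /cycleP[j ij]].
by rewrite inE a_eq1 -(a_fix i).1 ij b_v.
Qed.

(** Regularity makes the flags one orbit. An automorphism stabilizing [A] preserves ranks, hence
    fixes each face of the chain [A], and is trivial. *)
Lemma card_poset_aut : is_regular T -> #|poset_aut T| = #|flags T|.
Proof.
move=> reg; rewrite -(atransP reg A Af) card_orbit.
suff ->: 'C_(poset_aut T)[A | 'P^*] = 1 by rewrite indexg1.
apply/trivgP/subsetP=> s /setIP[sA /astab1P sE]; apply/set1P.
have fixA x : x \in A -> s x = x.
  move=> xA; apply: (rk_comparable_inj polyP); last by rewrite aut_rk.
  apply: (flag_comparable Af) => //; rewrite -sE.
  exact: (imset_f (aperm^~ s)).
by apply: free => //; apply: fixA.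
Qed.

End BaseFlag.

(** * Application to tight orientably-regular polyhedra *)

Theorem theorem3p3 (d : Order.disp_t) (T : finTBPOrderType d) (rk : T -> int)
    (p q : nat) (p_ge3 : 3 <= p) (p_odd : odd p)
    (polyP : is_polyhedron rk) (typeP : has_type rk p q) (tightP : tight T p q)
    (orientP : orientably_regular rk) :
  [/\ ~~ odd q, q %| 2 * p & isomorphic [subg (poset_aut T)] (gamma_group p q)].
Proof.
have [reg [A [r0 [r1 [r2 [Af R0 R1 R2 ind2]]]]]] := orientP.
have [v [e [f [[vA eA fA] [rv re rf ve ef]]]]] := flag_faces polyP Af.
have r0K : (r0 ^+ 2 = 1)%g by apply: (reflection0K polyP Af vA eA fA rv re rf ve ef R0).
have r1K : (r1 ^+ 2 = 1)%g by apply: (reflection1K polyP Af vA eA fA rv re rf ve ef R1).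
have r2K : (r2 ^+ 2 = 1)%g by apply: (reflection2K polyP Af vA eA fA rv re rf ve ef R2).
have r02K : ((r0 * r2) ^+ 2 = 1)%g.
  by apply: (reflection02K polyP Af vA eA fA rv re rf ve ef R0 R2).
have [r1n r2n r02n] := reflections_distinct polyP Af vA eA fA rv re rf R0 R1 R2.
have oa : #[(r0 * r1)%g]%g = p.
  by apply: (facet_rotation_order polyP typeP Af vA eA fA rv re rf ve ef R0 R1).
have ob : #[(r1 * r2)%g]%g = q.
  by apply: (vertex_rotation_order polyP typeP Af vA eA fA rv re rf ve ef R1 R2).
have TI := rotations_TI polyP typeP Af vA eA fA rv re rf ve ef R0 R1 R2.
have oG := card_poset_aut polyP Af vA eA fA rv re rf ve ef reg.
rewrite tightP in oG.
by apply: (@tight_regular_group _ _ r0 r1 r2);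
  rewrite ?(ltn_trans _ p_ge3) //; [case: R0 | case: R1 | case: R2].
Qed.
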